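(* Let $\mathfrak{A}$ be the boolean algebra of finite and cofinite subsets of $\mathbb{N}$. The bounded meet-semilattice $\mathcal{NO}(\mathfrak{A})$ of necessity operators on $\mathfrak{A}$ is neither distributive nor a lattice.
   Context: A necessity operator on a boolean algebra $B$ is a function $\Box\colon B\to B$ preserving finite meets (including the empty meet, so $\Box 1=1$). $\mathcal{NO}(B)$ is the set of necessity operators on $B$, ordered pointwise: $f\le g$ iff $f(a)\le g(a)$ for all $a\in B$; it is a bounded meet-semilattice with pointwise binary meets. A meet-semilattice $L$ is distributive if for all $a,b,c\in L$, $b\wedge c\le a$ implies that there are $b'\ge b$ and $c'\ge c$ with $a=b'\wedge c'$. *)

(* Defs.v *)
From HB Require Import structures.
From mathcomp Require Import all_boot all_order.
From mathcomp Require Import boolp classical_sets functions cardinality.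

Set Implicit Arguments.
Unset Strict Implicit.
Unset Printing Implicit Defensive.

Import Order.TTheory.
Local Open Scope order_scope.

(* The library's [distrLatticeType] requires joins; this notion only uses the
   meet. *)
Definition distributive_meet_semilattice d (L : meetSemilatticeType d) : Prop :=
  forall a b c : L, b `&` c <= a ->
    exists b' c' : L, [/\ b <= b', c <= c' & a = b' `&` c'].

Definition is_lattice d (L : porderType d) : Prop :=
  forall x y : L,
    (infimums [set x; y] !=set0 /\ supremums [set x; y] !=set0)%classic.

(* Boolean algebras are [ctbDistrLatticeType]s. *)
Section NecessityOperators.
Variables (d : Order.disp_t) (B : ctbDistrLatticeType d).

(* The empty sequence gives [f \top = \top]. *)
Definition preserves_finite_meets (f : B -> B) : Prop :=
  forall s : seq B, f (\meet_(a <- s) a) = \meet_(a <- s) f a.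

Lemma preserves_finite_meetsP (f : B -> B) :
  preserves_finite_meets f <->
  f \top = \top /\ {morph f : a b / a `&` b >-> a `&` b}.
Proof.
split=> [fP|[f1 fI] s]; last exact: (big_morph f fI f1).
split=> [|a b]; first by have := fP [::]; rewrite !big_nil.
by have := fP [:: a; b]; rewrite !big_cons !big_nil !meetx1.
Qed.

Definition necessity : {pred B -> B} :=
  [pred f : B -> B | `[< preserves_finite_meets f >]].

Record NO := NecessityOp { box :> B -> B; _ : box \in necessity }.

HB.instance Definition _ := [isSub for box].
HB.instance Definition _ := [Choice of NO by <:].
(* The order inherited from [B -> B], where it is the pointwise one. *)
HB.instance Definition _ := [SubChoice_isSubPOrder of NO by <: with d].

Lemma NO_leP (f g : NO) : reflect (forall a, f a <= g a) (f <= g).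
Proof. exact: (@lefP B d B f g). Qed.

Lemma NO_axiom (f : NO) : f \top = \top /\ {morph f : a b / a `&` b >-> a `&` b}.
Proof. by case: f => f /= /asboolP/preserves_finite_meetsP. Qed.

Fact NO_meet_subproof (f g : NO) : (fun a => f a `&` g a) \in necessity.
Proof.
apply/asboolP/preserves_finite_meetsP.
have [f1 fI] := NO_axiom f; have [g1 gI] := NO_axiom g.
by split=> [|a b]; rewrite ?f1 ?g1 ?meetxx// fI gI meetACA.
Qed.

Definition NO_meet (f g : NO) : NO := NecessityOp (NO_meet_subproof f g).

Fact NO_lexI (f g h : NO) : (f <= NO_meet g h) = (f <= g) && (f <= h).
Proof.
apply/NO_leP/andP => [fgh|[/NO_leP fg /NO_leP fh] a]; last by rewrite /= lexI fg fh.
by split; apply/NO_leP => a; have := fgh a; rewrite /= lexI => /andP[].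
Qed.

HB.instance Definition _ := Order.POrder_isMeetSemilattice.Build d NO NO_lexI.

Fact NO_top_subproof : (fun _ => \top) \in necessity.
Proof.
by apply/asboolP/preserves_finite_meetsP; split=> // a b; rewrite meetxx.
Qed.

Fact NO_bot_subproof :
  (fun a => if a == \top then \top else \bot) \in necessity.
Proof.
apply/asboolP/preserves_finite_meetsP; split=> [|a b]; first by rewrite eqxx.
rewrite -!le1x lexI.
by case: (\top <= a); case: (\top <= b); rewrite ?meetxx ?meetx0 ?meet0x.
Qed.

Fact NO_lex1 (f : NO) : f <= NecessityOp NO_top_subproof.
Proof. by apply/NO_leP => a /=; exact: lex1. Qed.

Fact NO_le0x (f : NO) : NecessityOp NO_bot_subproof <= f.
Proof.
apply/NO_leP => a /=; have [->|_] := eqVneq a \top; last exact: le0x.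
by case: (NO_axiom f) => ->.
Qed.

HB.instance Definition _ := Order.hasTop.Build d NO NO_lex1.
HB.instance Definition _ := Order.hasBottom.Build d NO NO_le0x.

End NecessityOperators.

Section FiniteCofinite.
Variable T : Type.

Definition finite_or_cofinite : {pred set T} :=
  [pred A : set T | `[< finite_set A \/ cofinite_set A >]].

Record fincof := FinCof { fincof_set :> set T;
                          _ : fincof_set \in finite_or_cofinite }.

HB.instance Definition _ := [isSub for fincof_set].
HB.instance Definition _ := [Choice of fincof by <:].

Local Open Scope classical_set_scope.

Fact finite_or_cofiniteC (A : set T) :
  A \in finite_or_cofinite -> ~` A \in finite_or_cofinite.
Proof.
move=> /asboolP AP; apply/asboolP; rewrite setCK.
by case: AP => ?; [right|left].
Qed.

Fact finite_or_cofiniteI : meet_closed finite_or_cofinite.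
Proof.
move=> A B /asboolP AP /asboolP BP; apply/asboolP; rewrite meetEset.
case: AP => [Af|Ac]; first by left; exact: finite_setIl.
case: BP => [Bf|Bc]; first by left; exact: finite_setIr.
by right; rewrite cofinite_setI.
Qed.

Fact finite_or_cofiniteU : join_closed finite_or_cofinite.
Proof.
move=> A B AP BP; rewrite joinEset -[A `|` B]setCK setCU.
apply: finite_or_cofiniteC; rewrite -meetEset.
by apply: finite_or_cofiniteI; exact: finite_or_cofiniteC.
Qed.

Fact finite_or_cofinite0 : \bot%O \in finite_or_cofinite.
Proof. by apply/asboolP; left; exact: finite_set0. Qed.

Fact finite_or_cofinite1 : \top%O \in finite_or_cofinite.
Proof. by apply/asboolP; right; exact: cofinite_setT. Qed.

HB.instance Definition _ := Order.isTBLatticeClosed.Build _ _ finite_or_cofinite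
  finite_or_cofiniteI finite_or_cofiniteU
  finite_or_cofinite0 finite_or_cofinite1.
HB.instance Definition _ :=
  [SubChoice_isTBSubLattice of fincof by <: with set_display].

Definition fincof_compl (A : fincof) : fincof :=
  FinCof (finite_or_cofiniteC (valP A)).

Local Close Scope classical_set_scope.

Fact fincof_meetUl : @left_distributive fincof fincof Order.meet Order.join.
Proof. by move=> A B C; apply: val_inj; exact: setIUl. Qed.

HB.instance Definition _ :=
  Order.Lattice_Meet_isDistrLattice.Build set_display fincof fincof_meetUl.

Fact fincof_joinxC (A : fincof) : A `|` fincof_compl A = \top.
Proof. by apply: val_inj; exact: setUv. Qed.

Fact fincof_meetxC (A : fincof) : A `&` fincof_compl A = \bot.
Proof. by apply: val_inj; exact: setICr. Qed.

HB.instance Definition _ := Order.TBDistrLattice_hasComplement.Build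
  set_display fincof fincof_joinxC fincof_meetxC.

Lemma fincof_leP (A B : fincof) :
  reflect (fincof_set A `<=` fincof_set B)%classic (A <= B).
Proof. exact: (@subsetPset T A B). Qed.

End FiniteCofinite.

(* Main.v *)
Require Import Defs.
From mathcomp Require Import all_boot all_order.
From mathcomp Require Import boolp classical_sets functions cardinality.

(** A necessity operator on the finite-cofinite algebra is dually a continuous
    closed-valued relation on the one-point compactification of the naturals,
    and the order is reversed inclusion. Let [p_b] fix the numbers of parity [b]
    and send every other [n] to [n + 1]. An operator above both [id] and the
    preimage operator of [p_b] has a relation contained in the intersection of
    the two graphs, hence its value at the empty set contains every [n] of
    parity [~~ b]; that value is then cofinite. On the other hand, each single
    point of parity [b] can be kept out of it, so there is no least upper bound.
    Distributivity fails because the meet of the preimage operators of [p_0] and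
    [p_1] is below [id]: the two operators provided by it would have cofinite
    values at the empty set, whose intersection cannot be empty. *)

Set Implicit Arguments.
Unset Strict Implicit.
Unset Printing Implicit Defensive.

Import Order.Theory.

Local Open Scope classical_set_scope.
Local Open Scope order_scope.

Section NecessityOperators.
Context {d : Order.disp_t} {B : ctbDistrLatticeType d}.

Fact id_necessity : id \in @necessity d B.
Proof. by apply/asboolP/preserves_finite_meetsP. Qed.

Definition NO_id : NO B := NecessityOp id_necessity.

Fact join_necessity (c : B) : Order.join c \in @necessity d B.
Proof.
apply/asboolP/preserves_finite_meetsP; split; first exact: joinx1.
by move=> x y; rewrite joinIr.
Qed.

(** Dually, the identity relation restricted to the complement of [c]. *)
Definition NO_joinl (c : B) : NO B := NecessityOp (join_necessity c).

End NecessityOperators.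

Section Preimage.
Variables (T : Type) (p : T -> T).
Hypothesis p_proper : forall A, finite_set A -> finite_set (p @^-1` A).

Fact preimage_finite_or_cofinite (A : fincof T) :
  p @^-1` A \in @finite_or_cofinite T.
Proof.
apply/asboolP; case: A => A /= /asboolP [Af|Ac]; first by left; exact: p_proper.
by right; rewrite preimage_setC; exact: p_proper.
Qed.

Definition fincof_preimage (A : fincof T) : fincof T :=
  FinCof (preimage_finite_or_cofinite A).

Fact preimage_necessity :
  fincof_preimage \in @necessity _ (fincof T).
Proof.
by apply/asboolP/preserves_finite_meetsP; split=> [|A C]; exact: val_inj.
Qed.

Definition NO_preimage : NO (fincof T) := NecessityOp preimage_necessity.

Fact singleton_finite_or_cofinite (x : T) : [set x] \in @finite_or_cofinite T.
Proof. by apply/asboolP; left; exact: finite_set1. Qed.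

Definition fincof1 (x : T) : fincof T := FinCof (singleton_finite_or_cofinite x).

Lemma ub_id_preimage_bot (s : NO (fincof T)) (x : T) :
  NO_id <= s -> NO_preimage <= s -> p x <> x -> fincof_set (s \bot) x.
Proof.
move=> /NO_leP ids /NO_leP ps pxx.
have [_ sI] := NO_axiom s.
(* Split [\bot] as {x} meet its complement: [ids] puts x in the value at the first, [ps] with
   [p x <> x] in that at the second. *)
rewrite -(meetxC (fincof1 x)) sI; split.
  by have /fincof_leP := ids (fincof1 x); exact.
by have /fincof_leP := ps (~` (fincof1 x)); exact.
Qed.

Lemma ub_id_preimage_joinl (x : T) :
  p x = x -> NO_id <= NO_joinl (~` fincof1 x) /\
             NO_preimage <= NO_joinl (~` fincof1 x).
Proof.
move=> pxx; split; apply/NO_leP => A /=; first exact: leUr.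
apply/fincof_leP => y /= Apy.
have [yx|yx] := pselect (y = x); last by left.
by right; move: Apy; rewrite /preimage/= yx pxx.
Qed.

End Preimage.

Section ParityRound.
Variable b : bool.

Definition parity_round (n : nat) : nat := (n + (odd n != b))%N.

Lemma parity_round_id n : odd n = b -> parity_round n = n.
Proof. by move=> nb; rewrite /parity_round nb eqxx addn0. Qed.

Lemma parity_round_neq n : odd n = ~~ b -> parity_round n <> n.
Proof.
by move=> nb; rewrite /parity_round nb; case: b => /=; rewrite addn1 => /esym/n_Sn.
Qed.

Lemma parity_round_proper (A : set nat) :
  finite_set A -> finite_set (parity_round @^-1` A).
Proof.
(* As n is at most [parity_round n], the fibre over m lies below m + 1. *)
move=> Af; apply: (@sub_finite_set _ _ (\bigcup_(m in A) `I_m.+1)).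
  by move=> n An; exists (parity_round n) => //=; rewrite ltnS leq_addr.
by apply: bigcup_finite => // m _; exact: finite_II.
Qed.

Lemma infinite_parity : infinite_set [set n | odd n = b].
Proof.
move=> /(finite_image half); rewrite (_ : _ @` _ = setT); first exact: infinite_nat.
apply/seteqP; split=> // n _; exists (b + n.*2)%N => /=.
  by rewrite oddD odd_double; case: b.
by rewrite half_bit_double.
Qed.

End ParityRound.

Definition NO_round (b : bool) : NO (fincof nat) :=
  NO_preimage (@parity_round_proper b).

Lemma ub_id_round_bot_cofinite b (s : NO (fincof nat)) :
  NO_id <= s -> NO_round b <= s -> cofinite_set (fincof_set (s \bot)).
Proof.
move=> ids ps; case: (asboolP _ (valP (s \bot))) => // sf.
case: (@infinite_parity (~~ b)); apply: sub_finite_set sf => n /= nb.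
by apply: ub_id_preimage_bot ps _ => //; exact: parity_round_neq.
Qed.

Lemma id_round_no_supremum b :
  ~ (supremums [set NO_id; NO_round b] !=set0)%classic.
Proof.
case=> s [sub sleast].
have sc : cofinite_set (fincof_set (s \bot)).
  by apply: (@ub_id_round_bot_cofinite b); apply: sub; [left|right].
apply: (@infinite_parity b); apply: sub_finite_set sc => n /= nb sn.
(* Joining with the complement of n gives an upper bound whose value at [\bot] omits n; hence so
   does that of [s]. *)
have [idn pn] := ub_id_preimage_joinl (@parity_round_proper b)
  (parity_round_id nb).
have /NO_leP/(_ \bot)/fincof_leP/(_ n sn) : s <= NO_joinl (~` fincof1 n).
  by apply: (sleast (NO_joinl (~` fincof1 n))) => h [] ->; [exact: idn|exact: pn].
by case=> [/(_ erefl)|].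
Qed.

Lemma meet_round_le_id : NO_round false `&` NO_round true <= NO_id.
Proof.
apply/NO_leP => A; apply/fincof_leP => n /= [An0 An1].
(* Each n is fixed by the rounding to its own parity. *)
by rewrite -(parity_round_id (erefl (odd n))); case: (odd n).
Qed.

Theorem corollary2p8 :
  ~ distributive_meet_semilattice (NO (fincof nat)) /\
  ~ is_lattice (NO (fincof nat)).
Proof.
split=> [dist|lat]; last first.
  by have [_ /id_round_no_supremum] := lat NO_id (NO_round false).
have [f [g [pf pg idE]]] := dist _ _ _ meet_round_le_id.
have fc : cofinite_set (fincof_set (f \bot)).
  by apply: ub_id_round_bot_cofinite pf; rewrite idE leIl.
have gc : cofinite_set (fincof_set (g \bot)).
  by apply: ub_id_round_bot_cofinite pg; rewrite idE leIr.
apply: infinite_nat; rewrite -setC0.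
rewrite (_ : set0 = fincof_set ((f `&` g) \bot)); last by rewrite -idE.
by rewrite setCI finite_setU.
Qed.
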